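(* Let $V=V_0+V_1$ satisfy the assumptions in the context. Then the effective diffusion tensor $\mathcal{M}$ defined in the context is uniformly positive definite over $\mathbb{R}^d$. In particular, for all $x\in\mathbb{R}^d$ and all $e\in\mathbb{R}^d$ with $|e|=1$, $$0<e^{-\mathrm{osc}(V_1)/\sigma}\le\frac{1}{Z_1(x)\widehat{Z}_1(x)}\le e\cdot\mathcal{M}(x)e\le1,$$ where $$Z_1(x)=\int_{(\mathbb{T}^d)^N}e^{-V_1(x,x_1,\ldots,x_N)/\sigma}\,dx_1\cdots dx_N,\qquad\widehat{Z}_1(x)=\int_{(\mathbb{T}^d)^N}e^{V_1(x,x_1,\ldots,x_N)/\sigma}\,dx_1\cdots dx_N,$$ and $\mathrm{osc}(V_1)=\sup V_1-\inf V_1$, the supremum and infimum being taken over $\mathbb{R}^d\times(\mathbb{T}^d)^N$.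
   Context: Fix integers $d,N\ge1$ and $\sigma>0$. $\mathbb{T}^d=\mathbb{R}^d/\mathbb{Z}^d$ is the unit torus (volume $1$). Assumptions: $V:\mathbb{R}^d\times(\mathbb{T}^d)^N\to\mathbb{R}$ is smooth and $V(x_0,x_1,\ldots,x_N)=V_0(x_0)+V_1(x_0,x_1,\ldots,x_N)$, where $V_0$ is smooth, $e^{-V_0}\in L^1(\mathbb{R}^d)$, $V_0(x)\to\infty$ as $|x|\to\infty$, $\nabla^2V_0\in L^\infty(\mathbb{R}^d)$, and $V_1$ is smooth and uniformly bounded on $\mathbb{R}^d\times(\mathbb{T}^d)^N$. Notation: for a vector field $\theta$, $(\nabla_x\theta^\top)_{ij}=\partial_{x_i}\theta_j$. Effective diffusion tensor: set $\mathcal{K}_N(x_0,\ldots,x_N)=e^{-V(x_0,\ldots,x_N)/\sigma}I$, with $I$ the $d\times d$ identity. Recursively for $k=N,\ldots,1$: $\theta_k=\theta_k(x_0,\ldots,x_k)\in\mathbb{R}^d$, with $\theta_k(x_0,\ldots,x_{k-1},\cdot)\in H^1(\mathbb{T}^d)$, is the weak solution (unique up to an additive constant for fixed $x_0,\ldots,x_{k-1}$) on $\mathbb{T}^d$ of: for every $e\in\mathbb{R}^d$, $\nabla_{x_k}\cdot\big(\mathcal{K}_k(\nabla_{x_k}(\theta_k\cdot e)+e)\big)=0$. For $k\le N-1$, $$\mathcal{K}_k(x_0,\ldots,x_k)=\int_{(\mathbb{T}^d)^{N-k}}(I+\nabla_{x_N}\theta_N^\top)\cdots(I+\nabla_{x_{k+1}}\theta_{k+1}^\top)e^{-V/\sigma}\,dx_N\cdots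 dx_{k+1}.$$ With $Z(x)=\int_{(\mathbb{T}^d)^N}e^{-V(x,x_1,\ldots,x_N)/\sigma}\,dx_N\cdots dx_1$, $$\mathcal{M}(x)=\frac{1}{Z(x)}\int_{(\mathbb{T}^d)^N}(I+\nabla_{x_N}\theta_N^\top)\cdots(I+\nabla_{x_1}\theta_1^\top)e^{-V(x,x_1,\ldots,x_N)/\sigma}\,dx_N\cdots dx_1 .$$ *)

(* Defs.v *)
From HB Require Import structures.
From mathcomp Require Import all_boot all_order all_algebra.
From mathcomp Require Import all_classical all_reals all_analysis.
Set Implicit Arguments.
Unset Strict Implicit.
Unset Printing Implicit Defensive.
Import Order.TTheory GRing.Theory Num.Theory.
Import numFieldNormedType.Exports.
Local Open Scope classical_set_scope.
Local Open Scope ring_scope.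

Section lebesgue_tuple.
Context {R : realType}.
Notation RT := (measurableTypeR R).

Definition pair_cons n (p : (RT * n.-tuple RT)%type) : n.+1.-tuple RT :=
  [the n.+1.-tuple RT of p.1 :: p.2].

Lemma measurable_pair_cons n :
  measurable_fun [set: (RT * n.-tuple RT)%type] (@pair_cons n).
Proof. by apply: measurable_cons. Qed.

Definition tuple_split n (t : n.+1.-tuple RT) : (RT * n.-tuple RT)%type :=
  (tnth t ord0, [tuple of behead t]).

Lemma measurable_tuple_split n :
  measurable_fun [set: n.+1.-tuple RT] (@tuple_split n).
Proof.
apply/measurable_fun_pairP; split.
- exact: measurable_tnth.
- exact: measurable_behead.
Qed.

Lemma pair_consK n : cancel (@pair_cons n) (@tuple_split n).
Proof. by case=> x t; rewrite /tuple_split; congr pair; exact/val_inj. Qed.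

Section cons_measure.
Context n (mu : {sigma_finite_measure set (n.-tuple RT) -> \bar R}).

Definition cons_measure : set (n.+1.-tuple RT) -> \bar R :=
  pushforward (lebesgue_measure \x mu)%E (@pair_cons n).

Let cm0 : cons_measure set0 = 0%E.
Proof. by rewrite /cons_measure /pushforward preimage_set0 measure0. Qed.

Let cm_ge0 A : (0 <= cons_measure A)%E.
Proof. by rewrite /cons_measure /pushforward; exact: measure_ge0. Qed.

Let cm_sigma : semi_sigma_additive cons_measure.
Proof.
move=> F mF tF mUF; rewrite /cons_measure /pushforward preimage_bigcup.
apply: measure_semi_sigma_additive.
- by move=> k; rewrite -[X in measurable X]setTI; exact: measurable_pair_cons.
- apply/trivIsetP => /= i j _ _ ij; rewrite -preimage_setI.
  by move/trivIsetP : tF => /(_ _ _ _ _ ij) ->//; rewrite preimage_set0.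
- rewrite -preimage_bigcup -[X in measurable X]setTI.
  exact: measurable_pair_cons.
Qed.

HB.instance Definition _ :=
  isMeasure.Build _ _ _ cons_measure cm0 cm_ge0 cm_sigma.

Let cm_sigma_finite : sigma_finite setT cons_measure.
Proof.
have /sigma_finiteP[F [TF ndF Foo]] :=
  sigma_finiteT (@lebesgue_measure R).
have /sigma_finiteP[G [TG ndG Goo]] := sigma_finiteT mu.
exists (fun k => @tuple_split n @^-1` (F k `*` G k)).
  rewrite -preimage_bigcup (_ : \bigcup_k _ = setT) ?preimage_setT//.
  apply/seteqP; split=> // -[x y] _.
  have [i _ Fix] : (\bigcup_i F i) x by rewrite -TF.
  have [j _ Gjy] : (\bigcup_i G i) y by rewrite -TG.
  exists (maxn i j) => //; split => /=.
  - by move: x Fix; exact/subsetPset/ndF/leq_maxl.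
  - by move: y Gjy; exact/subsetPset/ndG/leq_maxr.
move=> k; have [mF Fk] := Foo k; have [mG Gk] := Goo k.
have mFG : measurable (F k `*` G k) by exact: measurableX.
split.
  by rewrite -[X in measurable X]setTI; exact: measurable_tuple_split.
rewrite /cons_measure /pushforward -comp_preimage.
have -> : @tuple_split n \o @pair_cons n = id by apply/funext/pair_consK.
by rewrite preimage_id product_measure1E// lte_mul_pinfty// ge0_fin_numE.
Qed.

HB.instance Definition _ :=
  Measure_isSigmaFinite.Build _ _ _ cons_measure cm_sigma_finite.

End cons_measure.

Fixpoint lebesgue_tuple (n : nat) :
    {sigma_finite_measure set (n.-tuple RT) -> \bar R} :=
  match n with
  | 0 => dirac [tuple]
  | m.+1 => cons_measure (lebesgue_tuple m)
  end.


Lemma lebesgue_tuple_box n (A : 'I_n -> set RT) :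
  (forall i, measurable (A i)) ->
  lebesgue_tuple n [set t | forall i, A i (tnth t i)] =
  (\prod_(i < n) lebesgue_measure (A i))%E.
Proof.
elim: n A => [|n IH] A mA /=.
  rewrite big_ord0 diracE mem_set//=.
  by case.
rewrite big_ord_recl -IH// -product_measure1E//.
- rewrite /cons_measure /pushforward; congr (product_measure1 _ _ _).
  apply/seteqP; split=> [[x t] /= Axt|[x t] /= [Ax At] i].
    split; first exact: (Axt ord0).
    by move=> i; have := Axt (lift ord0 i); rewrite /pair_cons tnthS.
  case: (unliftP ord0 i) => [j|] ->; last exact: Ax.
  by rewrite /pair_cons tnthS; exact: At.
- rewrite (_ : mkset _ = \bigcap_(i in [set: 'I_n])
      ((@tnth n RT)^~ i @^-1` A (lift ord0 i))).
    apply: fin_bigcap_measurable => // i _.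
    by rewrite -[X in measurable X]setTI; exact: measurable_tnth.
  by apply/seteqP; split=> t /= At i *; exact: At.
Qed.

End lebesgue_tuple.

Section smooth.
Context {R : realType} {U : normedModType R}.

Fixpoint of_class_C (n : nat) (f : U -> R) : Prop :=
  continuous f /\
  match n with
  | 0 => True
  | m.+1 => forall v, (forall x, derivable f x v) /\ of_class_C m ('D_v f)
  end.

Definition smooth (f : U -> R) : Prop := forall n, of_class_C n f.

End smooth.

Section torus.
Context {R : realType} {d : nat}.

Definition unit_vec (i : 'I_d) : 'rV[R]_d := delta_mx ord0 i.

(* Functions on T^d = R^d / Z^d are Z^d-periodic functions on R^d. *)
Definition torus_periodic (T : Type) (f : 'rV[R]_d -> T) : Prop :=
  forall x i, f (x + unit_vec i) = f x.

Definition point_of (t : d.-tuple (measurableTypeR R)) : 'rV[R]_d :=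
  \row_i tnth t i.

Definition cell : set (d.-tuple (measurableTypeR R)) :=
  [set t | forall i, 0 <= tnth t i < 1].

Definition torus_int (f : 'rV[R]_d -> R) : R :=
  \int[lebesgue_tuple d]_(t in cell) f (point_of t).

Definition torus_L2 (f : 'rV[R]_d -> R) : Prop :=
  [/\ torus_periodic f,
      measurable_fun [set: d.-tuple (measurableTypeR R)] (f \o point_of) &
      (\int[lebesgue_tuple d]_(t in cell) ((f (point_of t) ^+ 2)%:E)
        < +oo)%E].

(* u belongs to H^1(T^d), with weak gradient g. *)
Definition torus_H1 (u : 'rV[R]_d -> R) (g : 'rV[R]_d -> 'cV[R]_d) : Prop :=
  [/\ torus_L2 u,
      forall i, torus_L2 (fun y => g y i ord0) &
      forall phi : 'rV[R]_d -> R, smooth phi -> torus_periodic phi ->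
      forall i, torus_int (fun y => u y * 'D_(unit_vec i) phi y) =
                - torus_int (fun y => g y i ord0 * phi y)].

(* Euclidean structure: the norm `|_| of the library on matrices is the
   sup norm. *)
Definition dotv (u v : 'cV[R]_d) : R := \sum_i u i ord0 * v i ord0.
Definition enorm (u : 'cV[R]_d) : R := Num.sqrt (dotv u u).

(* Positive definite includes symmetric. *)
Definition uniformly_posdef (A : 'rV[R]_d -> 'M[R]_d) : Prop :=
  (forall x, (A x)^T = A x) /\
  exists2 c, 0 < c & forall x e, c * dotv e e <= dotv e (A x *m e).

End torus.

(* A point (x_0, ..., x_N) of R^d x (R^d)^N is the matrix whose row i is x_i.
   Functions on R^d x (T^d)^N are the ones that are periodic in the rows
   1, ..., N; functions of (x_0, ..., x_k) are the ones that do not depend on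
   the rows k+1, ..., N. *)
Section multiscale.
Context {R : realType} {d N : nat}.
Notation point := 'M[R]_(N.+1, d).

Definition set_row (X : point) (k : 'I_N.+1) (y : 'rV[R]_d) : point :=
  \matrix_(i, l) if i == k then y ord0 l else X i l.

Definition fast_periodic (T : Type) (F : point -> T) : Prop :=
  forall X (j : 'I_N.+1) i, (0 < j)%N -> F (X + delta_mx j i) = F X.

Definition depends_upto (k : 'I_N.+1) (T : Type) (F : point -> T) : Prop :=
  forall X Y : point,
    (forall i : 'I_N.+1, (i <= k)%N -> row i X = row i Y) -> F X = F Y.

Record separable_potential (V0 : 'rV[R]_d -> R) (V1 V : point -> R) : Prop := {
  potential_split : forall X, V X = V0 (row ord0 X) + V1 X ;
  potential_smooth : smooth V ;
  potential_periodic : fast_periodic V ;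
  slow_smooth : smooth V0 ;
  slow_exp_L1 : (lebesgue_tuple d).-integrable setT
                  (fun t => (expR (- V0 (point_of t)))%:E) ;
  slow_confining : forall A : R, exists B : R, forall x, B < `|x| -> A < V0 x ;
  (* The second derivatives are continuous: L^infinity is boundedness. *)
  slow_hessian_bounded : exists C : R, forall x i j,
    `| 'D_(unit_vec i) ('D_(unit_vec j) V0) x | <= C ;
  fast_smooth : smooth V1 ;
  fast_fast_periodic : fast_periodic V1 ;
  fast_bounded : exists C : R, forall X, `| V1 X | <= C }.

Definition int_row (k : 'I_N.+1) (F : point -> R) (X : point) : R :=
  torus_int (fun y => F (set_row X k y)).

(* The integral dx_N ... dx_{k+1}, as an iterated integral with dx_N innermost:
   the weak gradients below are only determined almost everywhere on each
   slice, so that joint measurability in x_{k+1}, ..., x_N is not assumed. *)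
Definition int_above (k : 'I_N.+1) (F : point -> R) : point -> R :=
  foldr int_row F [seq j : 'I_N.+1 <- enum 'I_N.+1 | (k < j)%N].

(* In what follows [G j X] stands for the matrix grad_{x_j} theta_j^T at X, with
   entries (G j X) a b = d theta_{j,b} / d x_{j,a}. *)

(* The factors are in decreasing order of j: (I + G_N) ... (I + G_{k+1}). *)
Definition corrector_prod (G : 'I_N.+1 -> point -> 'M[R]_d) (k : 'I_N.+1)
    (X : point) : 'M[R]_d :=
  \big[mulmx/1%:M]_(j <- rev (enum 'I_N.+1) | (k < j)%N) (1%:M + G j X).

(* The tensor K_k; for k = N the product and the integral are empty, and
   this is exp(-V/sigma) I. *)
Definition tensorK (sigma : R) (V : point -> R)
    (G : 'I_N.+1 -> point -> 'M[R]_d) (k : 'I_N.+1) (X : point) : 'M[R]_d :=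
  \matrix_(a, b)
    int_above k (fun Y => corrector_prod G k Y a b * expR (- V Y / sigma)) X.

(* theta_1, ..., theta_N are the correctors, and G_1, ..., G_N are their weak
   gradients; index 0 is unused. The equation for theta_k involves only
   G_{k+1}, ..., G_N, through K_k. *)
Definition correctors (sigma : R) (V : point -> R)
    (theta : 'I_N.+1 -> point -> 'cV[R]_d)
    (G : 'I_N.+1 -> point -> 'M[R]_d) : Prop :=
  forall k : 'I_N.+1, (0 < k)%N ->
  [/\ depends_upto k (theta k) /\ fast_periodic (theta k),
      depends_upto k (G k) /\ fast_periodic (G k),
      forall X b, torus_H1 (fun y => theta k (set_row X k y) b ord0)
                           (fun y => col b (G k (set_row X k y))) &
      forall X (e : 'cV[R]_d) (phi : 'rV[R]_d -> R) (g : 'rV[R]_d -> 'cV[R]_d),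
        torus_H1 phi g ->
        torus_int (fun y =>
          dotv (tensorK sigma V G k (set_row X k y) *m
                  (G k (set_row X k y) *m e + e)) (g y)) = 0].

(* The rows 1, ..., N of this point are irrelevant once they are integrated
   out. *)
Definition slow_point (x : 'rV[R]_d) : point := set_row 0 ord0 x.

Definition partition_fun (W : point -> R) (x : 'rV[R]_d) : R :=
  int_above ord0 (fun X => expR (W X)) (slow_point x).

Definition effective_diffusion (sigma : R) (V : point -> R)
    (G : 'I_N.+1 -> point -> 'M[R]_d) (x : 'rV[R]_d) : 'M[R]_d :=
  (partition_fun (fun X => - V X / sigma) x)^-1 *:
    tensorK sigma V G ord0 (slow_point x).

Definition osc (F : point -> R) : R := sup (range F) - inf (range F).

End multiscale.

(* Main.v *)
Require Import Defs.
From mathcomp Require Import all_boot all_order all_algebra.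
From mathcomp Require Import all_classical all_reals all_analysis.
From mathcomp Require Import measurable_realfun ring lra.
Set Implicit Arguments.
Unset Strict Implicit.
Unset Printing Implicit Defensive.
Import Order.TTheory GRing.Theory Num.Theory.
Import numFieldNormedType.Exports.
Local Open Scope classical_set_scope.
Local Open Scope ring_scope.

(* K_{k-1} is the homogenized matrix of the slice K_k(x_0, ..., x_{k-1}, .), and
   e . K_{k-1} e is the minimum over gradients g of the integral of
   (e + g) . K_k (e + g). The competitor g = 0 gives the upper bound; the lower
   bound comes from the fact that gradients have mean zero, by the
   Cauchy-Schwarz inequality. Iterating from K_N = exp(-V/sigma) I yields
   1 / int exp(V/sigma) <= K_0 <= int exp(-V/sigma).
   The slices of K_k have to be measurable for the weak formulation to be
   usable, although the G_k are only determined almost everywhere on each slice: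
   K_k is in fact continuous, because A' <= (1 + t) A for two slices implies the
   same inequality between their homogenized matrices. *)

(** * Measurability and integration over the unit cell *)

Section torus_integral.
Context {R : realType} {d : nat}.
Notation RT := (measurableTypeR R).
Implicit Types f g : 'rV[R]_d -> R.

(** Integrals run over the half-open [cell]; its closure is compact, which provides bounds and
    uniform estimates for continuous functions. *)
Definition closed_cell : set 'rV[R]_d :=
  [set y | forall i, `[0, 1]%classic (y ord0 i)].

Lemma closed_cell_compact : compact closed_cell.
Proof.
apply: (@rV_compact R d (fun=> `[0, 1]%classic : set R)) => i.
exact: segment_compact.
Qed.

Lemma point_of_cell (t : d.-tuple RT) : cell t -> closed_cell (point_of t).
Proof.
move=> ct i; have /andP[t0 t1] := ct i.
by rewrite /= mxE in_itv/= t0 ltW.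
Qed.

Lemma measurable_all_tnth (A : 'I_d -> set RT) :
  (forall i, measurable (A i)) ->
  measurable [set t : d.-tuple RT | forall i, A i (tnth t i)].
Proof.
move=> mA; rewrite (_ : mkset _ = \bigcap_(i in [set: 'I_d])
    ((@tnth d RT)^~ i @^-1` A i)).
  apply: fin_bigcap_measurable => // i _.
  by rewrite -[X in measurable X]setTI; exact: measurable_tnth.
by apply/seteqP; split=> t /= At i *; exact: At.
Qed.

Lemma cellE :
  cell = [set t : d.-tuple RT | forall i, `[0%R, 1%R[%classic (tnth t i)].
Proof. by apply/seteqP; split => t /= ct i; have := ct i; rewrite in_itv. Qed.

Lemma measurable_cell : measurable (@cell R d).
Proof.
rewrite cellE; apply: (@measurable_all_tnth (fun=> `[0%R, 1%R[%classic)) => i.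
exact: measurable_itv.
Qed.

Lemma lebesgue_cell : lebesgue_tuple d (@cell R d) = 1%E.
Proof.
rewrite cellE (@lebesgue_tuple_box _ _ (fun=> `[0%R, 1%R[%classic)).
  by rewrite big1// => i _;
    rewrite lebesgue_measure_itv/= lte_fin ltr01 oppr0 adde0.
by move=> i; exact: measurable_itv.
Qed.

(** Measurability is asked on the whole space, as in [torus_L2]; integrability below is asked on
    [cell] only. *)
Definition cell_measurable f :=
  measurable_fun [set: d.-tuple RT] (f \o point_of).

Definition cell_integrable f :=
  (lebesgue_tuple d).-integrable cell (EFin \o (f \o point_of)).


(* An open subset of R^d is a countable union of rational cubes. *)
Lemma cell_measurable_continuous f : continuous f -> cell_measurable f.
Proof.
move=> /continuousP cf.
apply: (measurability _ (RGenOpens.measurableE R)) => // _ [_ [a [b ->]] <-].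
rewrite setTI.
set U := `]a, b[%classic; have oU : open U by exact: interval_open.
pose cube (p : d.-tuple rat * nat) : set (d.-tuple RT) :=
  [set t | forall i, ball (ratr (tnth p.1 i) : R) p.2.+1%:R^-1 (tnth t i)].
pose good p := cube p `<=` (f \o point_of) @^-1` U.
rewrite (_ : _ @^-1` U = \bigcup_(n in [set: nat])
    (if unpickle n is Some p then if `[< good p >] then cube p else set0
     else set0)).
  apply: bigcupT_measurable => n; case: unpickle => [p|//].
  case: asboolP => // _.
  apply: (@measurable_all_tnth
    (fun i => ball (ratr (tnth p.1 i) : R) p.2.+1%:R^-1)) => i.
  exact: measurable_ball.
apply/seteqP; split => [t /= Ut|t [n _]]; last first.
  by case: unpickle => [p|//]; case: asboolP => // gp ct; exact: gp.
have /nbhs_ballP[e e0 eU] : nbhs (point_of t) (f @^-1` U).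
  by apply: open_nbhs_nbhs; split => //; exact: cf.
(* Two points of a cube differ in each coordinate by less than twice its radius, so a cube around
   [t] of radius below e/2 stays in the ball of radius e. *)
have [n ne] : exists n, n.+1%:R^-1 < e / 2.
  have e20 : 0 < e / 2 by rewrite divr_gt0//; exact: e0.
  near \oo => n; exists n; near: n; exact: near_infty_natSinv_lt (PosNum e20).
have /(_ _)/cid-/all_sig[q qt] (i : 'I_d) :
    exists q : rat, ball (ratr q : R) n.+1%:R^-1 (tnth t i).
  set z : R := tnth t i; set r : R := n.+1%:R^-1.
  have : z - r < z + r by rewrite ltrBlDr -addrA ltrDl addr_gt0// invr_gt0.
  move=> /rat_in_itvoo[q]; rewrite in_itv/= => /andP[q1 q2]; exists q.
  by rewrite /ball/= ltr_distl -ltrBlDr q1/= -ltrBrDr opprK q2.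
exists (pickle ([tuple q i | i < d], n)) => //; rewrite pickleK.
have ct : cube ([tuple q i | i < d], n) t by move=> i; rewrite /= tnth_mktuple.
rewrite asboolT// => s cs; apply: eU; split => // k j; rewrite /point_of !mxE.
apply: (@le_ball _ _ _ (n.+1%:R^-1 + n.+1%:R^-1)).
  by rewrite [e]splitr lerD// ltW.
have := cs j; have := ct j; rewrite /= => cb1 cb2.
by apply: (ball_triangle _ cb2); exact: ball_sym.
Unshelve. all: by end_near. Qed.

Lemma cell_measurableD f g : cell_measurable f -> cell_measurable g ->
  cell_measurable (fun y => f y + g y).
Proof. exact: measurable_funD. Qed.

Lemma cell_measurableM f g : cell_measurable f -> cell_measurable g ->
  cell_measurable (fun y => f y * g y).
Proof. exact: measurable_funM. Qed.

Lemma cell_measurable_cst r : cell_measurable (fun=> r).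
Proof. exact: measurable_cst. Qed.

Lemma cell_integrable_bounded f M : cell_measurable f ->
  (forall y, closed_cell y -> `|f y| <= M) -> cell_integrable f.
Proof.
move=> mf fM; apply: measurable_bounded_integrable.
- exact: measurable_cell.
- by rewrite [ltLHS]lebesgue_cell ltry.
- exact: measurable_funS mf.
- exists M; split; rewrite ?num_real// => r /ltW Mr t /point_of_cell ct.
  exact: le_trans (fM _ ct) Mr.
Qed.

Lemma closed_cell_bounded f : continuous f ->
  exists2 M, 0 < M & forall y, closed_cell y -> `|f y| <= M.
Proof.
move=> cf.
have : compact (f @` closed_cell).
  by apply: continuous_compact closed_cell_compact; exact: continuous_subspaceT.
move=> /compact_bounded[M [_ fM]]; exists (`|M| + 1) => [|y cy].
  by rewrite ltr_wpDl.
apply: fM; last by exists y.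
by rewrite (le_lt_trans (ler_norm M))// ltrDl.
Qed.

Lemma cell_integrable_continuous f : continuous f -> cell_integrable f.
Proof.
move=> cf; have [M _ fM] := closed_cell_bounded cf.
exact: (cell_integrable_bounded (cell_measurable_continuous cf) fM).
Qed.

Lemma cell_integrableD f g : cell_integrable f -> cell_integrable g ->
  cell_integrable (fun y => f y + g y).
Proof.
move=> If Ig; rewrite /cell_integrable (_ : _ \o _ =
  (EFin \o (f \o point_of)) \+ (EFin \o (g \o point_of)))%E//.
by apply: integrableD => //; exact: measurable_cell.
Qed.

Lemma cell_integrableZ r f : cell_integrable f ->
  cell_integrable (fun y => r * f y).
Proof.
move=> If; rewrite /cell_integrable (_ : _ \o _ =
  fun t => r%:E * ((EFin \o (f \o point_of)) t))%E//.
by apply: integrableZl => //; exact: measurable_cell.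
Qed.

Lemma cell_integrableN f : cell_integrable f ->
  cell_integrable (fun y => - f y).
Proof.
by move=> /(cell_integrableZ (-1)); under eq_fun do rewrite mulN1r.
Qed.

Lemma cell_integrableB f g : cell_integrable f -> cell_integrable g ->
  cell_integrable (fun y => f y - g y).
Proof. by move=> If /cell_integrableN; exact: cell_integrableD. Qed.

Lemma cell_integrable_cst r : cell_integrable (fun=> r).
Proof. exact/cell_integrable_continuous/cst_continuous. Qed.

Lemma cell_integrable_sum I (s : seq I) (F : I -> 'rV[R]_d -> R) :
  (forall i, cell_integrable (F i)) ->
  cell_integrable (fun y => \sum_(i <- s) F i y).
Proof.
move=> IF; elim: s => [|i s ih].
  by under eq_fun do rewrite big_nil; exact: cell_integrable_cst.
by under eq_fun do rewrite big_cons; exact: cell_integrableD.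
Qed.

Lemma torus_intD f g : cell_integrable f -> cell_integrable g ->
  torus_int (fun y => f y + g y) = torus_int f + torus_int g.
Proof. by move=> If Ig; apply: RintegralD => //; exact: measurable_cell. Qed.

Lemma torus_intZ r f : cell_integrable f ->
  torus_int (fun y => r * f y) = r * torus_int f.
Proof. by move=> If; apply: (RintegralZl _ _ If); exact: measurable_cell. Qed.

Lemma torus_intB f g : cell_integrable f -> cell_integrable g ->
  torus_int (fun y => f y - g y) = torus_int f - torus_int g.
Proof. by move=> If Ig; apply: RintegralB => //; exact: measurable_cell. Qed.

Lemma torus_int_cst (r : R) : torus_int (fun _ : 'rV[R]_d => r) = r.
Proof.
rewrite /torus_int Rintegral_cst; last exact: measurable_cell.
by rewrite [X in fine X]lebesgue_cell mulr1.
Qed.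

Lemma torus_int_sum I (s : seq I) (F : I -> 'rV[R]_d -> R) :
  (forall i, cell_integrable (F i)) ->
  torus_int (fun y => \sum_(i <- s) F i y) = \sum_(i <- s) torus_int (F i).
Proof.
move=> IF; elim: s => [|i s ih].
  by under eq_fun do rewrite big_nil; rewrite torus_int_cst big_nil.
under eq_fun do rewrite big_cons; rewrite big_cons torus_intD// ?ih//.
exact: cell_integrable_sum.
Qed.

Lemma le_torus_int f g : cell_integrable f -> cell_integrable g ->
  (forall y, closed_cell y -> f y <= g y) -> torus_int f <= torus_int g.
Proof.
move=> If Ig fg; apply: le_Rintegral => //; first exact: measurable_cell.
by move=> t /point_of_cell; exact: fg.
Qed.

Lemma cell_integrable_le f g : cell_measurable f -> cell_integrable g ->
  (forall y, `|f y| <= g y) -> cell_integrable f.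
Proof.
move=> mf Ig fg; apply: le_integrable Ig; first exact: measurable_cell.
  by apply/measurable_EFinP; exact: measurable_funS mf.
move=> t _ /=; rewrite lee_fin (le_trans (fg _))// ler_norm//.
Qed.

Lemma torus_L2_sqr f : torus_L2 f -> cell_integrable (fun y => f y ^+ 2).
Proof.
move=> [_ mf foo].
have mf2 : measurable_fun cell ((fun y => f y ^+ 2) \o point_of).
  exact: (measurable_funS measurableT (@subsetT _ _) (cell_measurableM mf mf)).
apply/integrableP; split; first exact/measurable_EFinP.
rewrite (le_lt_trans _ foo)//=; apply: ge0_le_integral => //=.
- exact: measurable_cell.
- by do 2 apply: measurableT_comp => //.
- exact/measurable_EFinP.
- by move=> t _; rewrite lee_fin ger0_norm// sqr_ge0.
Qed.

(** The cell has finite measure and |f| <= 1 + f^2. *)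
Lemma torus_L2_integrable f : torus_L2 f -> cell_integrable f.
Proof.
move=> L2f; have [_ mf _] := L2f.
have I1f2 := cell_integrableD (cell_integrable_cst 1) (torus_L2_sqr L2f).
apply: (cell_integrable_le mf I1f2) => y.
rewrite ler_norml; apply/andP; split; nra.
Qed.

Lemma torus_L2_mul f g : torus_L2 f -> torus_L2 g ->
  cell_integrable (fun y => f y * g y).
Proof.
move=> L2f L2g; have [_ mf _] := L2f; have [_ mg _] := L2g.
have If2g2 := cell_integrableD (torus_L2_sqr L2f) (torus_L2_sqr L2g).
apply: (cell_integrable_le (cell_measurableM mf mg) If2g2) => y.
rewrite ler_norml; apply/andP; split; nra.
Qed.

(** The continuous factor is bounded on [closed_cell] but perhaps not on the whole space, so the
    domination is made on the cell only. *)
Lemma cell_integrable_continuousM f g :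
  continuous f -> cell_measurable g -> cell_integrable g ->
  cell_integrable (fun y => f y * g y).
Proof.
move=> cf mg Ig.
have [M M0 fM] := closed_cell_bounded cf.
apply: (@le_integrable _ _ _ _ _ measurable_cell _
  (EFin \o ((fun y => M * g y) \o point_of))).
- apply/measurable_EFinP; apply: measurable_funS (cell_measurableM _ mg) => //.
  exact: cell_measurable_continuous.
- move=> t /point_of_cell /fM fMt /=; rewrite lee_fin !normrM ler_wpM2r//.
  by rewrite (le_trans fMt)// ler_norm.
- exact: cell_integrableZ.
Qed.

Lemma torus_L2_linear r f g : torus_L2 f -> torus_L2 g ->
  torus_L2 (fun y => r * f y + g y).
Proof.
move=> L2f L2g; have [pf mf _] := L2f; have [pg mg _] := L2g.
split.
- by move=> y i; rewrite pf pg.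
- exact: cell_measurableD (cell_measurableM (cell_measurable_cst r) mf) mg.
- have : cell_integrable (fun y => (r * f y + g y) ^+ 2).
    rewrite (_ : (fun y => _) = fun y =>
        (r ^+ 2 * f y ^+ 2 + (2 * r) * (f y * g y)) + g y ^+ 2).
      apply: cell_integrableD; last exact: torus_L2_sqr.
      apply: cell_integrableD; apply: cell_integrableZ.
        exact: torus_L2_sqr.
      exact: torus_L2_mul.
    by apply/funext => y; ring.
  move=> /integrableP[_]; apply: le_lt_trans.
  rewrite le_eqVlt; apply/orP; left; apply/eqP.
  by apply: eq_integral => t _ /=; rewrite ger0_norm// sqr_ge0.
Qed.

End torus_integral.

(** * Quadratic forms on R^d *)

Section dot_product.
Context {R : realType} {d : nat}.
Implicit Types u v w : 'cV[R]_d.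

Lemma dotvC u v : dotv u v = dotv v u.
Proof. by apply: eq_bigr => i _; rewrite mulrC. Qed.

Lemma dotvDr u v w : dotv u (v + w) = dotv u v + dotv u w.
Proof. by rewrite -big_split; apply: eq_bigr => i _; rewrite mxE mulrDr. Qed.

Lemma dotvDl u v w : dotv (v + w) u = dotv v u + dotv w u.
Proof. by rewrite dotvC dotvDr !(dotvC u). Qed.

Lemma dotvZr r u v : dotv u (r *: v) = r * dotv u v.
Proof. by rewrite mulr_sumr; apply: eq_bigr => i _; rewrite mxE; ring. Qed.

Lemma dotvZl r u v : dotv (r *: u) v = r * dotv u v.
Proof. by rewrite dotvC dotvZr dotvC. Qed.

Lemma dotvv_ge0 u : 0 <= dotv u u.
Proof. by apply: sumr_ge0 => i _; rewrite -expr2 sqr_ge0. Qed.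

Lemma dotv_delta (i : 'I_d) u : dotv (delta_mx i ord0) u = u i ord0.
Proof.
rewrite /dotv (bigD1 i)//= big1 ?addr0; first by rewrite mxE !eqxx mul1r.
by move=> j /negPf ji; rewrite mxE ji mul0r.
Qed.

Lemma dotv_delta_mulmx (A : 'M[R]_d) i j :
  dotv (delta_mx i ord0) (A *m delta_mx j ord0) = A i j.
Proof. by rewrite dotv_delta -colE mxE. Qed.

Lemma dotv_trmx (A : 'M[R]_d) u v : dotv u (A *m v) = dotv v (A^T *m u).
Proof.
rewrite /dotv; under eq_bigr do rewrite mxE mulr_sumr.
under [RHS]eq_bigr do rewrite mxE mulr_sumr.
rewrite exchange_big/=; apply: eq_bigr => i _; apply: eq_bigr => j _.
by rewrite mxE; ring.
Qed.

(** Polarization. It transfers continuity from the quadratic form, where variational estimates live,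
    to the entries of the matrix. *)
Lemma quadratic_form_entry (A : 'M[R]_d) i j : A^T = A ->
  let q v := dotv v (A *m v) in let v k : 'cV[R]_d := delta_mx k ord0 in
  A i j = (q (v i + v j) - q (v i) - q (v j)) / 2.
Proof.
move=> sA q v; rewrite -(dotv_delta_mulmx A) /q mulmxDr !dotvDl !dotvDr.
by rewrite [in dotv (v j) (A *m v i)]dotv_trmx sA; field.
Qed.

End dot_product.

(** * The space of weak gradients on the torus *)

Section weak_gradients.
Context {R : realType} {d : nat}.
Implicit Types (u phi : 'rV[R]_d -> R) (g h p q : 'rV[R]_d -> 'cV[R]_d).

Definition field_L2 p := forall i, torus_L2 (fun y => p y i ord0).

(** The potential is quantified away: the corrector equation and the energies see only the
    gradient. *)
Definition weak_gradient g := exists u, torus_H1 u g.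

Lemma weak_gradient_L2 g : weak_gradient g -> field_L2 g.
Proof. by move=> [u []]. Qed.

Lemma torus_L2_cst (r : R) : torus_L2 (fun _ : 'rV[R]_d => r).
Proof.
split => //; first exact: cell_measurable_cst.
have /integrableP[_] := @cell_integrable_cst R d (r ^+ 2).
apply: le_lt_trans; rewrite le_eqVlt; apply/orP; left; apply/eqP.
by apply: eq_integral => t _ /=; rewrite ger0_norm// sqr_ge0.
Qed.

Lemma field_L2_cst (e : 'cV[R]_d) : field_L2 (fun=> e).
Proof. by move=> i; exact: torus_L2_cst. Qed.

Lemma field_L2_linear r p q : field_L2 p -> field_L2 q ->
  field_L2 (fun y => r *: p y + q y).
Proof.
move=> L2p L2q i; under eq_fun do rewrite !mxE.
exact: torus_L2_linear.
Qed.

Lemma field_L2D p q : field_L2 p -> field_L2 q -> field_L2 (fun y => p y + q y).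
Proof.
move=> L2p L2q; under eq_fun do rewrite -[p _]scale1r.
exact: field_L2_linear.
Qed.

Lemma smooth_continuous (U : normedModType R) (f : U -> R) :
  smooth f -> continuous f.
Proof. by move=> /(_ 0%N)[]. Qed.

Lemma smooth_derive_continuous (U : normedModType R) (f : U -> R) v :
  smooth f -> continuous ('D_v f).
Proof. by move=> /(_ 1%N)[_ /(_ v)[_ []]]. Qed.

Lemma smooth_cst (U : normedModType R) (r : R) : smooth (fun _ : U => r).
Proof.
move=> n; elim: n r => [|n ih] r /=;
  (split; first exact: cst_continuous) => // v.
split; first by move=> x; exact: derivable_cst.
rewrite (_ : 'D_v _ = fun=> 0)//.
by apply/funext => x; rewrite derive_cst.
Qed.

Lemma cell_integrable_L2M_continuous (f u : 'rV[R]_d -> R) :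
  continuous f -> torus_L2 u ->
  cell_integrable (fun y => f y * u y).
Proof.
move=> cf L2u; have [_ mu _] := L2u.
by apply: cell_integrable_continuousM => //; exact: torus_L2_integrable.
Qed.

Lemma weak_gradient_linear r g h : weak_gradient g -> weak_gradient h ->
  weak_gradient (fun y => r *: g y + h y).
Proof.
move=> [u [L2u L2g ug]] [v [L2v L2h vh]].
exists (fun y => r * u y + v y); split.
- exact: torus_L2_linear.
- exact: field_L2_linear.
move=> phi sphi pphi i.
have cphi := smooth_continuous sphi.
have cDphi := smooth_derive_continuous (v := unit_vec i) sphi.
have I1 := cell_integrable_L2M_continuous cDphi L2u.
have I2 := cell_integrable_L2M_continuous cDphi L2v.
have I3 := cell_integrable_L2M_continuous cphi (L2g i).
have I4 := cell_integrable_L2M_continuous cphi (L2h i).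
transitivity (r * torus_int (fun y => u y * 'D_(unit_vec i) phi y) +
              torus_int (fun y => v y * 'D_(unit_vec i) phi y)).
  under [in RHS]eq_fun do rewrite mulrC.
  under [X in _ + torus_int X]eq_fun do rewrite mulrC.
  rewrite -torus_intZ// -torus_intD//; last exact: cell_integrableZ.
  by congr torus_int; apply/funext => y; ring.
rewrite ug// vh// mulrN -opprD; congr (- _).
under eq_fun do rewrite mulrC.
under [X in _ + torus_int X]eq_fun do rewrite mulrC.
rewrite -torus_intZ// -torus_intD//; last exact: cell_integrableZ.
by congr torus_int; apply/funext => y; rewrite !mxE; ring.
Qed.

Lemma weak_gradient0 : weak_gradient (fun=> 0).
Proof.
exists (fun=> 0); split; first exact: torus_L2_cst.
  exact: field_L2_cst.
move=> phi _ _ i; under eq_fun do rewrite mul0r.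
by under [in RHS]eq_fun do rewrite mxE mul0r; rewrite torus_int_cst oppr0.
Qed.

(** The product is the combination of the columns of [H] with the coordinates of [e] as weights. *)
Lemma weak_gradient_mulmx (H : 'rV[R]_d -> 'M[R]_d) e :
  (forall b, weak_gradient (fun y => col b (H y))) ->
  weak_gradient (fun y => H y *m e).
Proof.
move=> gH.
have -> : (fun y => H y *m e) = fun y => \sum_b e b ord0 *: col b (H y).
  apply/funext => y; apply/colP => a; rewrite summxE mxE.
  by apply: eq_bigr => b _; rewrite !mxE mulrC.
elim: (index_enum _) => [|b s ih].
  by under eq_fun do rewrite big_nil; exact: weak_gradient0.
by under eq_fun do rewrite big_cons; exact: weak_gradient_linear.
Qed.

(** Test the weak derivative with the constant function 1. *)
Lemma torus_int_weak_gradient g i : weak_gradient g ->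
  torus_int (fun y => g y i ord0) = 0.
Proof.
move=> [u [_ _ /(_ (fun=> 1) (@smooth_cst _ 1) (fun _ _ => erefl) i)]].
under eq_fun do rewrite derive_cst mulr0.
under [in RHS]eq_fun do rewrite mulr1.
rewrite torus_int_cst => /esym/eqP.
by rewrite oppr_eq0 => /eqP.
Qed.

End weak_gradients.

(** * The cell problem and the variational bounds on the homogenized matrix *)

Section cell_problem.
Context {R : realType} {d : nat}.
Implicit Types (A H : 'rV[R]_d -> 'M[R]_d) (p q g : 'rV[R]_d -> 'cV[R]_d).
Implicit Types (w : 'rV[R]_d -> R) (e : 'cV[R]_d).

(** Continuity makes the energies of L2 fields finite; a quantitative lower bound is supplied
    separately, by the weight of [homogenized_ge]. *)
Record continuous_tensor A : Prop := {
  tensor_continuous : forall a b, continuous (fun y => A y a b) ;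
  tensor_sym : forall y, (A y)^T = A y ;
  tensor_ge0 : forall y v, 0 <= dotv v (A y *m v) }.

(** All weak gradients are admissible test fields, in particular those coming from the corrector of
    another tensor. *)
Definition cell_corrector A H :=
  (forall b, weak_gradient (fun y => col b (H y))) /\
  forall e g, weak_gradient g ->
    torus_int (fun y => dotv (A y *m (H y *m e + e)) (g y)) = 0.

(** Column b of [H] is the gradient of the b-th corrector, so column b of the integrand is the flux
    of the corrected unit field e_b. *)
Definition homogenized A H : 'M[R]_d :=
  \matrix_(a, b) torus_int (fun y => (A y *m (1%:M + H y)) a b).

Definition energy A p q : R := torus_int (fun y => dotv (A y *m p y) (q y)).

Lemma cell_integrable_energy A p q : continuous_tensor A ->
  field_L2 p -> field_L2 q ->
  cell_integrable (fun y => dotv (A y *m p y) (q y)).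
Proof.
move=> [cA _ _] L2p L2q; apply: cell_integrable_sum => a.
under eq_fun do rewrite mxE mulr_suml.
apply: cell_integrable_sum => b.
under eq_fun do rewrite -mulrA.
have [_ mp _] := L2p b; have [_ mq _] := L2q a.
apply: cell_integrable_continuousM; first exact: cA.
  exact: cell_measurableM.
exact: torus_L2_mul.
Qed.

Lemma energyC A p q : continuous_tensor A -> energy A p q = energy A q p.
Proof.
move=> [_ sA _]; congr torus_int; apply/funext => y.
by rewrite dotvC dotv_trmx sA dotvC.
Qed.

Lemma energyDr A p q g : continuous_tensor A ->
  field_L2 p -> field_L2 q -> field_L2 g ->
  energy A p (fun y => q y + g y) = energy A p q + energy A p g.
Proof.
move=> cA L2p L2q L2g; rewrite /energy -torus_intD; first last.
- exact: cell_integrable_energy.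
- exact: cell_integrable_energy.
- by congr torus_int; apply/funext => y; rewrite dotvDr.
Qed.

Lemma energyDl A p q g : continuous_tensor A ->
  field_L2 p -> field_L2 q -> field_L2 g ->
  energy A (fun y => q y + g y) p = energy A q p + energy A g p.
Proof. by move=> cA *; rewrite energyC// energyDr// !(energyC p). Qed.

Lemma energy_ge0 A p : continuous_tensor A -> 0 <= energy A p p.
Proof.
by move=> [_ _ A0]; apply: Rintegral_ge0 => t _; rewrite dotvC; exact: A0.
Qed.

(** Entry (a, b) is the energy density of the corrected field of e_b against the constant field
    e_a. *)
Lemma cell_integrable_homogenized A H :
  continuous_tensor A -> cell_corrector A H ->
  forall a b, cell_integrable (fun y => (A y *m (1%:M + H y)) a b).
Proof.
move=> cA [gH _] a b.
have := @cell_integrable_energy A (fun y => col b (H y) + delta_mx b ord0)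
  (fun=> delta_mx a ord0) cA.
have -> : (fun y =>
    dotv (A y *m (col b (H y) + delta_mx b ord0)) (delta_mx a ord0)) =
  (fun y => (A y *m (1%:M + H y)) a b).
  apply/funext => y; rewrite dotvC dotv_delta addrC.
  rewrite -[in RHS](dotv_delta_mulmx _ a b) -mulmxA mulmxDl mul1mx -colE.
  by rewrite dotv_delta.
apply; last exact: field_L2_cst.
by apply: field_L2D; [exact: weak_gradient_L2|exact: field_L2_cst].
Qed.

Section homogenized_theory.
Variables (A H : 'rV[R]_d -> 'M[R]_d).
Hypotheses (cA : continuous_tensor A) (AH : cell_corrector A H).

Let gH e : weak_gradient (fun y => H y *m e).
Proof. by apply: weak_gradient_mulmx; case: AH. Qed.

Let gHL2 e := weak_gradient_L2 (gH e).
Let ctL2 e := @field_L2_cst R d e.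
Let HeL2 e : field_L2 (fun y => H y *m e + e).
Proof. exact: field_L2D. Qed.

Lemma energy_corrector e g : weak_gradient g ->
  energy A (fun y => H y *m e + e) g = 0.
Proof. by case: AH => _; exact. Qed.

(** By the corrector equation, adding the gradient [H y *m e'] to the second argument costs nothing.
    In this form symmetry and nonnegativity are visible. *)
Lemma dotv_homogenized e e' : dotv e' (homogenized A H *m e) =
  energy A (fun y => H y *m e + e) (fun y => H y *m e' + e').
Proof.
rewrite energyDr// energy_corrector// add0r.
rewrite /energy /dotv.
transitivity (torus_int (fun y =>
    \sum_a \sum_b e' a ord0 * e b ord0 * (A y *m (1%:M + H y)) a b)).
  rewrite torus_int_sum; last first.
    move=> a; apply: cell_integrable_sum => b; apply: cell_integrableZ.
    exact: cell_integrable_homogenized.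
  apply: eq_bigr => a _; rewrite torus_int_sum; last first.
    by move=> b; apply: cell_integrableZ; exact: cell_integrable_homogenized.
  rewrite mxE mulr_sumr; apply: eq_bigr => b _; rewrite torus_intZ.
    by rewrite mxE; ring.
  exact: cell_integrable_homogenized.
congr torus_int; apply/funext => y; apply: eq_bigr => a _.
have -> : H y *m e + e = (1%:M + H y) *m e by rewrite mulmxDl mul1mx addrC.
rewrite mulmxA [(_ *m e) a _]mxE mulr_suml; apply: eq_bigr => b _; ring.
Qed.

Lemma homogenized_sym : (homogenized A H)^T = homogenized A H.
Proof.
apply/matrixP => a b; rewrite mxE.
rewrite -(dotv_delta_mulmx _ b a) -(dotv_delta_mulmx _ a b).
by rewrite !dotv_homogenized energyC.
Qed.

(** The competitor is the corrected field [p] plus a gradient [h]. The corrector equation makes [p]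
    orthogonal to [h] for the energy, and the excess is the energy of [h]. *)
Lemma homogenized_min e g : weak_gradient g ->
  dotv e (homogenized A H *m e) <=
  energy A (fun y => g y + e) (fun y => g y + e).
Proof.
move=> gg; rewrite dotv_homogenized.
set p := fun y => H y *m e + e.
pose h y := - 1 *: (H y *m e) + g y.
have gh : weak_gradient h by exact: weak_gradient_linear.
have hL2 := weak_gradient_L2 gh.
have -> : (fun y => g y + e) = fun y => p y + h y.
  by apply/funext => y; rewrite /p /h scaleN1r addrACA subrr add0r addrC.
have pL2 : field_L2 p by exact: HeL2.
have phL2 : field_L2 (fun y => p y + h y) by exact: field_L2D.
rewrite (energyDr cA phL2 pL2 hL2) (energyDl cA pL2 pL2 hL2).
rewrite (energyDl cA hL2 pL2 hL2) (energyC h p)// (energy_corrector e gh).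
by rewrite addr0 add0r lerDl energy_ge0.
Qed.

Lemma homogenized_ge0 e : 0 <= dotv e (homogenized A H *m e).
Proof. by rewrite dotv_homogenized energy_ge0. Qed.

Lemma homogenized_le w e : continuous w ->
  (forall y v, dotv v (A y *m v) <= w y * dotv v v) ->
  dotv e (homogenized A H *m e) <= torus_int w * dotv e e.
Proof.
move=> cw Aw; apply: le_trans (homogenized_min e weak_gradient0) _.
under eq_fun do rewrite add0r.
rewrite mulrC -torus_intZ; last exact: cell_integrable_continuous.
apply: le_torus_int.
- exact: cell_integrable_energy.
- by apply: cell_integrableZ; exact: cell_integrable_continuous.
- by move=> y _; rewrite dotvC mulrC.
Qed.

(** Cauchy-Schwarz in linearized form: |p|^2 / w >= 2 t e.p - t^2 w |e|^2 pointwise, for the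
    corrected field p. Since gradients have mean zero, e.p integrates to |e|^2, and the optimal t =
    1/W gives |e|^2 / W. *)
Lemma homogenized_ge w e : continuous w -> (forall y, 0 < w y) ->
  0 < torus_int w ->
  (forall y v, dotv v v / w y <= dotv v (A y *m v)) ->
  dotv e e / torus_int w <= dotv e (homogenized A H *m e).
Proof.
move=> cw w0 W0 wA; set W := torus_int w in W0 *; set t := W^-1.
have Iw := cell_integrable_continuous cw.
have IHe : cell_integrable (fun y => dotv e (H y *m e)).
  apply: cell_integrable_sum => i; apply: cell_integrableZ.
  exact/torus_L2_integrable/gHL2.
have : 2 * t * dotv e e - t ^+ 2 * dotv e e * W <=
    dotv e (homogenized A H *m e).
  have -> : 2 * t * dotv e e - t ^+ 2 * dotv e e * W = torus_int (fun y =>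
      (2 * t * dotv e (H y *m e) + 2 * t * dotv e e) - t ^+ 2 * dotv e e * w y).
    rewrite torus_intB; first last.
    - exact: cell_integrableZ.
    - by apply: cell_integrableD;
        [exact: cell_integrableZ|exact: cell_integrable_cst].
    rewrite torus_intD; [|exact: cell_integrableZ|exact: cell_integrable_cst].
    rewrite torus_int_cst !torus_intZ// torus_int_sum; last first.
      by move=> i; apply: cell_integrableZ; exact/torus_L2_integrable/gHL2.
    rewrite big1 ?mulr0 ?add0r// => i _; rewrite torus_intZ; last first.
      exact/torus_L2_integrable/gHL2.
    by rewrite torus_int_weak_gradient ?mulr0.
  rewrite dotv_homogenized; apply: le_torus_int.
  - apply: cell_integrableB; last exact: cell_integrableZ.
    by apply: cell_integrableD;
        [exact: cell_integrableZ|exact: cell_integrable_cst].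
  - exact: cell_integrable_energy.
  - move=> y _; rewrite [leRHS]dotvC; apply: le_trans (wA y _).
    rewrite ler_pdivlMr//.
    set p := H y *m e + e.
    have -> : 2 * t * dotv e (H y *m e) + 2 * t * dotv e e = 2 * t * dotv e p.
      by rewrite dotvDr mulrDr.
    clearbody p.
    (* Expanding this square gives the pointwise inequality multiplied by [w y]. *)
    have := dotvv_ge0 (p - (t * w y) *: e).
    rewrite -scaleNr !(dotvDl, dotvDr, dotvZl, dotvZr) (dotvC p e).
    by move: (dotv e p) (dotv e e) (dotv p p) => a b c; lra.
apply: le_trans; rewrite le_eqVlt; apply/orP; left; apply/eqP.
by rewrite /t; field; exact: lt0r_neq0.
Qed.

End homogenized_theory.

(** The corrector of [A] is a competitor in the minimization for [A']. The forms are compared on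
    [closed_cell] only, where compactness makes estimates uniform. *)
Lemma homogenized_compare A A' H H' c e :
  continuous_tensor A -> continuous_tensor A' ->
  cell_corrector A H -> cell_corrector A' H' ->
  (forall y v, closed_cell y -> dotv v (A' y *m v) <= c * dotv v (A y *m v)) ->
  dotv e (homogenized A' H' *m e) <= c * dotv e (homogenized A H *m e).
Proof.
move=> cA cA' AH A'H' A'A.
have gH : weak_gradient (fun y => H y *m e).
  by apply: weak_gradient_mulmx; case: AH.
have L2 : field_L2 (fun y => H y *m e + e).
  by apply: field_L2D; [exact: weak_gradient_L2|exact: field_L2_cst].
apply: le_trans (homogenized_min cA' A'H' e gH) _.
rewrite dotv_homogenized// -torus_intZ; last exact: cell_integrable_energy.
apply: le_torus_int.
- exact: cell_integrable_energy.
- by apply: cell_integrableZ; exact: cell_integrable_energy.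
- by move=> y cy; rewrite dotvC [X in _ <= _ * X]dotvC; exact: A'A.
Qed.

(** The reciprocal of [w] is continuous, hence bounded by some M on [closed_cell], so that w >= 1/M
    there. *)
Lemma torus_int_gt0 w : continuous w -> (forall y, 0 < w y) -> 0 < torus_int w.
Proof.
move=> cw w0.
have [M M0 wM] : exists2 M, 0 < M & forall y, closed_cell y -> `|(w y)^-1| <= M.
  apply: closed_cell_bounded => y; move: (w0 y) => /lt0r_neq0 wy.
  exact: (cvgV wy (cw y)).
apply: (@lt_le_trans _ _ M^-1); first by rewrite invr_gt0.
rewrite -[leLHS](@torus_int_cst R d); apply: le_torus_int.
- exact: cell_integrable_cst.
- exact: cell_integrable_continuous.
- move=> y /wM; rewrite gtr0_norm ?invr_gt0// => wyM.
  by rewrite -[leRHS]invrK lef_pV2// posrE invr_gt0.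
Qed.

End cell_problem.

(** * Slices and iterated integrals over the fast variables *)

Section slices.
Context {R : realType} {d N : nat}.
Notation point := 'M[R]_(N.+1, d).
Implicit Types (F W : point -> R) (X Y : point) (k : 'I_N.+1) (y : 'rV[R]_d).

Lemma row_set_row X k y j :
  row j (set_row X k y) = if j == k then y else row j X.
Proof. by apply/rowP => i; rewrite !mxE; case: eqP => //; rewrite mxE. Qed.

(** Joint continuity of [set_row]: balls of the sup norm are defined entrywise, so one radius serves
    for the row and for the point. *)
Lemma near_set_row X k y (P : set point) : nbhs (set_row X k y) P ->
  \forall y' \near y & X' \near X, P (set_row X' k y').
Proof.
move=> /nbhs_ballP[e e0 eP]; exists (ball y e, ball X e) => /=.
  by split; exact: nbhsx_ballx.
move=> [y' X'] /= [[_ yy'] [_ XX']]; apply: eP; split => // i j.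
by rewrite !mxE; case: eqP.
Qed.

(** A tube lemma. Near each [y] both values are within e/2 of the value of [F] at [set_row X k y];
    compactness of [closed_cell] makes the neighbourhood of [X] uniform in [y]. *)
Lemma near_slice F X k (e : R) : continuous F -> 0 < e ->
  \forall X' \near X, forall y, closed_cell y ->
    `|F (set_row X' k y) - F (set_row X k y)| < e.
Proof.
move=> cF e0.
have e20 : 0 < e / 2 by rewrite divr_gt0.
have := closed_cell_compact (R := R) (d := d).
rewrite compact_near_coveringP => cover.
apply: (cover _ (nbhs X)
  (fun X' y => `|F (set_row X' k y) - F (set_row X k y)| < e)) => y _.
have : nbhs (set_row X k y) [set Y | `|F (set_row X k y) - F Y| < e / 2].
  by have /cvgrPdist_lt := cF (set_row X k y); exact.
move=> /near_set_row[[A B] /= [yA XB] AB].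
exists (A, B) => //= -[y' X'] /= [Ay' BX'].
have /= := AB (y', X') (conj Ay' BX').
have /= := AB (y', X) (conj Ay' (nbhs_singleton XB)).
rewrite !ltr_norml => /andP[? ?] /andP[? ?]; apply/andP; split; lra.
Qed.

Lemma continuous_slice F X k : continuous F ->
  continuous (fun y => F (set_row X k y)).
Proof.
move=> cF y; apply: (@continuous_comp _ _ _ (set_row X k) F); last exact: cF.
move=> P /near_set_row[[A B] /= [yA XB] AB]; apply: filterS yA => y' Ay'.
exact: (AB (y', X) (conj Ay' (nbhs_singleton XB))).
Qed.

(** Uniform closeness of the slices passes to the integrals, the cell having volume 1. *)
Lemma int_row_continuous F k : continuous F -> continuous (int_row k F).
Proof.
move=> cF X; apply/(@cvgrPdist_le _ _ _ (nbhs X) _ _ _) => e e0.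
apply: filterS (near_slice X k cF e0) => X' FX'.
have IF Y := cell_integrable_continuous (continuous_slice (X := Y) (k := k) cF).
rewrite /int_row -torus_intB// ler_norml; apply/andP; split.
  rewrite -[leLHS](@torus_int_cst R d); apply: le_torus_int.
  - exact: cell_integrable_cst.
  - exact: cell_integrableB.
  - by move=> y /FX'; rewrite ltr_norml => /andP[? ?]; lra.
rewrite -[leRHS](@torus_int_cst R d); apply: le_torus_int.
- exact: cell_integrableB.
- exact: cell_integrable_cst.
- by move=> y /FX'; rewrite ltr_norml => /andP[? ?]; lra.
Qed.

Lemma int_above_continuous F k : continuous F -> continuous (int_above k F).
Proof.
rewrite /int_above => cF; elim: [seq _ <- _ | _] => //= j s ih.
exact: int_row_continuous.
Qed.

Lemma int_above_gt0 F k : continuous F -> (forall X, 0 < F X) ->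
  forall X, 0 < int_above k F X.
Proof.
rewrite /int_above => cF F0; set s := [seq _ <- _ | _].
(* Continuity is carried along because [torus_int_gt0] requires it at each integration. *)
suff : continuous (foldr int_row F s) /\ forall X, 0 < foldr int_row F s X.
  by case.
elim: s => //= j s [cs s0]; split; first exact: int_row_continuous.
by move=> X; apply: torus_int_gt0 => [|y //]; exact: continuous_slice.
Qed.

Lemma le_int_above F W k : continuous F -> continuous W ->
  (forall X, F X <= W X) -> forall X, int_above k F X <= int_above k W X.
Proof.
rewrite /int_above => cF cW FW; set s := [seq _ <- _ | _].
suff : [/\ continuous (foldr int_row F s), continuous (foldr int_row W s) &
  forall X, foldr int_row F s X <= foldr int_row W s X] by case.
elim: s => //= j s [cs ct st]; split; [exact: int_row_continuous..|].
by move=> X; apply: le_torus_int => //;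
  exact/cell_integrable_continuous/continuous_slice.
Qed.

Lemma int_above_cst k (r : R) : int_above k (fun _ : point => r) = fun=> r.
Proof.
rewrite /int_above; elim: [seq _ <- _ | _] => //= j s ->.
by apply/funext => X; rewrite /int_row torus_int_cst.
Qed.

Lemma int_aboveZ k F (c : point -> R) : continuous F -> depends_upto k c ->
  int_above k (fun X => c X * F X) = fun X => c X * int_above k F X.
Proof.
rewrite /int_above => cF cc; set s := [seq _ <- _ | _].
(* Every integrated row lies above [k], so [c] is constant in each of the integrals. *)
have : all (fun j : 'I_N.+1 => (k < j)%N) s by exact: filter_all.
suff : all (fun j : 'I_N.+1 => (k < j)%N) s -> continuous (foldr int_row F s) /\
  foldr int_row (fun X => c X * F X) s = fun X => c X * foldr int_row F s X.
  by move=> /[apply] -[].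
elim: s => //= j s ih /andP[kj /ih[cs ->]].
split; first exact: int_row_continuous.
apply/funext => X; rewrite /int_row.
rewrite -torus_intZ; last exact/cell_integrable_continuous/continuous_slice.
congr torus_int; apply/funext => y; congr (_ * _); apply: cc => i ik.
rewrite row_set_row; case: eqP => // ij.
by move: ik; rewrite ij leqNgt kj.
Qed.

(** Both lists are strictly increasing and have the same members. *)
Lemma filter_above k k' : k = k'.+1 :> nat ->
  [seq j : 'I_N.+1 <- enum 'I_N.+1 | (k' < j)%N] =
  k :: [seq j : 'I_N.+1 <- enum 'I_N.+1 | (k < j)%N].
Proof.
move=> kk'.
have srt (P : pred 'I_N.+1) :
    sorted (relpre val ltn) [seq j <- enum 'I_N.+1 | P j].
  apply: sorted_filter; first by move=> a b c /=; exact: ltn_trans.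
  by rewrite -sorted_map val_enum_ord iota_ltn_sorted.
apply: (@irr_sorted_eq _ (relpre val ltn)).
- by move=> a b c /=; exact: ltn_trans.
- by move=> a /=; rewrite ltnn.
- exact: srt.
- rewrite /= path_min_sorted ?srt//; apply/allP => j.
  by rewrite mem_filter => /andP[].
- move=> j; rewrite inE (mem_filter (fun j : 'I_N.+1 => (k' < j)%N)).
  rewrite (mem_filter (fun j : 'I_N.+1 => (k < j)%N)) mem_enum !andbT.
  by rewrite -kk' leq_eqVlt eq_sym -val_eqE eq_sym.
Qed.

Lemma int_above_recl k k' F : k = k'.+1 :> nat ->
  int_above k' F = int_row k (int_above k F).
Proof. by move=> kk'; rewrite /int_above (filter_above kk'). Qed.

(** In decreasing order the new, smallest index [k] comes last, so its factor stands on the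
    right. *)
Lemma corrector_prod_recr (G : 'I_N.+1 -> point -> 'M[R]_d) k k' X :
  k = k'.+1 :> nat ->
  corrector_prod G k' X = corrector_prod G k X *m (1%:M + G k X).
Proof.
move=> kk'; rewrite /corrector_prod -big_filter -[in RHS]big_filter.
rewrite !filter_rev (filter_above kk').
rewrite rev_cons big_rcons_op mulmx1.
elim: (rev _) => [|j s ih]; first by rewrite !big_nil mul1mx.
by rewrite !big_cons ih mulmxA.
Qed.

Lemma filter_above_max :
  [seq j : 'I_N.+1 <- enum 'I_N.+1 | ((ord_max : 'I_N.+1) < j)%N] = [::].
Proof.
rewrite (eq_in_filter (a2 := pred0)) ?filter_pred0// => j _ /=.
by apply/negbTE; rewrite -leqNgt -ltnS.
Qed.

Lemma int_above_max F : int_above ord_max F = F.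
Proof. by rewrite /int_above filter_above_max. Qed.

Lemma corrector_prod_max (G : 'I_N.+1 -> point -> 'M[R]_d) X :
  corrector_prod G ord_max X = 1%:M.
Proof.
by rewrite /corrector_prod -big_filter filter_rev filter_above_max big_nil.
Qed.

End slices.

(** * Continuous dependence of the homogenized matrix on the slice *)

Section homogenized_continuity.
Context {R : realType} {d N : nat}.
Notation point := 'M[R]_(N.+1, d).
Variables (K H : point -> 'M[R]_d) (w : point -> R) (k : 'I_N.+1).
Hypothesis K_continuous : forall a b, continuous (fun X => K X a b).
Hypothesis K_sym : forall X, (K X)^T = K X.
Hypothesis w_continuous : continuous w.
Hypothesis w_gt0 : forall X, 0 < w X.
Hypothesis K_ge : forall X v, dotv v v / w X <= dotv v (K X *m v).
Hypothesis KH : forall X,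
  cell_corrector (fun y => K (set_row X k y)) (fun y => H (set_row X k y)).

Let A X y := K (set_row X k y).
Let hom X := homogenized (A X) (fun y => H (set_row X k y)).

Lemma slice_tensor X : continuous_tensor (A X).
Proof.
split => [a b|y|y v].
- by apply: (continuous_slice (F := fun X => K X a b)); exact: K_continuous.
- exact: K_sym.
- by apply: le_trans (K_ge _ _); rewrite divr_ge0 ?dotvv_ge0// ltW.
Qed.

(** Bound |v_i v_j| by (v_i^2 + v_j^2) / 2 and sum over i and j. *)
Lemma quadratic_form_le (B : 'M[R]_d) (h : R) v : (forall a b, `|B a b| <= h) ->
  `|dotv v (B *m v)| <= h * d%:R * dotv v v.
Proof.
move=> Bh; rewrite /dotv.
apply: (@le_trans _ _
  (\sum_i \sum_j h * ((v i ord0 ^+ 2 + v j ord0 ^+ 2) / 2))).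
  apply: le_trans (ler_norm_sum _ _ _) _; apply: ler_sum => i _.
  rewrite mxE mulr_sumr; apply: le_trans (ler_norm_sum _ _ _) _.
  apply: ler_sum => j _; rewrite mulrCA normrM ler_pM// ler_norml.
  apply/andP; split.
    have := sqr_ge0 (v i ord0 + v j ord0); nra.
  have := sqr_ge0 (v i ord0 - v j ord0); nra.
set S := \sum_i v i ord0 * v i ord0.
have sumS : \sum_j v j ord0 ^+ 2 = S by apply: eq_bigr => j _; rewrite expr2.
under eq_bigr
  do rewrite -mulr_sumr -mulr_suml big_split/= sumS sumr_const card_ord.
rewrite -mulr_sumr -mulr_suml big_split/= sumr_const card_ord sumrMnl sumS.
by rewrite le_eqVlt; apply/orP; left; apply/eqP; rewrite -mulr_natr; field.
Qed.

Lemma homogenized_form_continuous e : continuous (fun X => dotv e (hom X *m e)).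
Proof.
move=> X; apply/(@cvgrPdist_lt _ _ _ (nbhs X) _ _ _) => eps eps0.
set h0 := dotv e (hom X *m e).
have h00 : 0 <= h0 by exact: homogenized_ge0 (slice_tensor X) (KH X) e.
have [M M0 wM] :=
  closed_cell_bounded (continuous_slice (X := X) (k := k) w_continuous).
(* With h1 the form at [X'], the comparisons h1 <= (1 + t) h0 and h0 <= (1 + t) h1, together with t
   <= 1, give |h1 - h0| <= 2 t h0 < eps. *)
set t := Num.min 1 (eps / (2 * (h0 + 1))).
have t0 : 0 < t.
  by rewrite lt_min ltr01/= divr_gt0// mulr_gt0// ltr_wpDl.
(* The entrywise tolerance that makes the two forms differ by at most t / (M + 1) |v|^2; d + 1
   absorbs the factor d of [quadratic_form_le] and is nonzero. *)
set h := t / (M + 1) / (d.+1)%:R.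
have h_gt0 : 0 < h by rewrite !divr_gt0// ltr_wpDl// ltW.
have near_K : \forall X' \near X, forall a b y, closed_cell y ->
    `|K (set_row X' k y) a b - K (set_row X k y) a b| < h.
  apply: (@filter_forall _ _ (fun a X' => forall b y, closed_cell y ->
    `|K (set_row X' k y) a b - K (set_row X k y) a b| < h) (nbhs X)) => a.
  apply: (@filter_forall _ _ (fun b X' => forall y, closed_cell y ->
    `|K (set_row X' k y) a b - K (set_row X k y) a b| < h) (nbhs X)) => b.
  exact: (near_slice _ _ (@K_continuous a b)).
apply: filterS2 near_K (near_slice X k w_continuous ltr01) => X' KX' wX'.
have qle y v : closed_cell y ->
    `|dotv v (A X' y *m v) - dotv v (A X y *m v)| <= t / (M + 1) * dotv v v.
  move=> cy; have -> : dotv v (A X' y *m v) - dotv v (A X y *m v) =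
      dotv v ((A X' y - A X y) *m v).
    by rewrite mulmxDl mulNmx dotvDr -[in RHS]scaleN1r dotvZr mulN1r.
  apply: le_trans (@quadratic_form_le _ h v _) _.
    by move=> a b; rewrite !mxE; apply/ltW/KX'.
  rewrite ler_wpM2r ?dotvv_ge0// /h -[leLHS]mulrA ler_piMr//.
    by rewrite divr_ge0// ltW// ltr_wpDl// ltW.
  by rewrite mulrC ler_pdivrMr ?ltr0n// mul1r ler_nat.
have dot_le Y y v : w (set_row Y k y) <= M + 1 ->
    dotv v v <= (M + 1) * dotv v (A Y y *m v).
  move=> wM1; have := K_ge (set_row Y k y) v.
  rewrite ler_pdivrMr// => /le_trans; apply.
  rewrite mulrC; apply: ler_wpM2r => //.
  exact: tensor_ge0 (slice_tensor Y) y v.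
have M10 : 0 < M + 1 by rewrite ltr_wpDl// ltW.
(* Coercivity turns the additive error into a multiplicative one. The bound M + 1 on [w] holds on
   both slices, because [w] moves by less than 1 from [X] to [X']. *)
have bound Y y v : w (set_row Y k y) <= M + 1 ->
    t / (M + 1) * dotv v v <= t * dotv v (A Y y *m v).
  move=> /(dot_le _ _ v); rewrite -mulrA ler_pM2l// => dle.
  by rewrite mulrC ler_pdivrMr// mulrC.
have le1 : dotv e (hom X' *m e) <= (1 + t) * h0.
  apply: homogenized_compare (slice_tensor X) (slice_tensor X') (KH X)
    (KH X') _.
  move=> y v cy.
  have := qle y v cy; rewrite ler_norml => /andP[_ q1].
  have wMy : w (set_row X k y) <= M := le_trans (ler_norm _) (wM y cy).
  have wM1 : w (set_row X k y) <= M + 1 by lra.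
  have := bound X y v wM1; lra.
have le2 : h0 <= (1 + t) * dotv e (hom X' *m e).
  apply: homogenized_compare (slice_tensor X') (slice_tensor X) (KH X')
    (KH X) _.
  move=> y v cy.
  have := qle y v cy; rewrite ler_norml => /andP[q1 _].
  have wMy : w (set_row X k y) <= M := le_trans (ler_norm _) (wM y cy).
  have := wX' y cy; rewrite ltr_norml => /andP[_ wX'y].
  have wM1 : w (set_row X' k y) <= M + 1 by lra.
  have := bound X' y v wM1; lra.
have t1 : t <= 1 by rewrite ge_min lexx.
have teps : 2 * t * h0 < eps.
  have : t * (2 * (h0 + 1)) <= eps.
    by rewrite -ler_pdivlMr ?mulr_gt0// ?ltr_wpDl// ge_min lexx orbT.
  nra.
rewrite -/h0; move: le1 le2 => /=; move: (dotv e _) => h1 le1 le2.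
rewrite ltr_norml; apply/andP; split; nra.
Qed.

Lemma homogenized_continuous a b : continuous (fun X => hom X a b).
Proof.
pose q v X := dotv v (hom X *m v); pose u i : 'cV[R]_d := delta_mx i ord0.
have -> : (fun X => hom X a b) =
    fun X => (q (u a + u b) X - q (u a) X - q (u b) X) / 2.
  apply/funext => X; apply: quadratic_form_entry.
  exact: homogenized_sym (slice_tensor X) (KH X).
under eq_fun do rewrite mulrC.
move=> X; apply: (@cvgMl_tmp _ _ (nbhs X)).
by apply: (@cvgB _ _ _ (nbhs X)); first apply: (@cvgB _ _ _ (nbhs X));
  exact: homogenized_form_continuous.
Qed.

End homogenized_continuity.

(** * Descending recursion on the scales *)

Section iterated_homogenization.
Context {R : realType} {d N : nat}.
Notation point := 'M[R]_(N.+1, d).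
Variables (sigma : R) (V : point -> R).
Variables (theta : 'I_N.+1 -> point -> 'cV[R]_d).
Variables (G : 'I_N.+1 -> point -> 'M[R]_d).
Hypothesis V_continuous : continuous V.
Hypothesis thetaG : correctors sigma V theta G.
Implicit Types (X : point) (k : 'I_N.+1).

Let K := tensorK sigma V G.
Let w k := int_above k (fun X => expR (- V X / sigma)).
Let what k := int_above k (fun X => expR (V X / sigma)).

Let hom k X :=
  homogenized (fun y => K k (set_row X k y)) (fun y => G k (set_row X k y)).

(* The corrector equation at level k sees only the integral over the rows above
   k, and the matrix h carries the later factors I + G_j, j <= k, out of it. *)
Let factors_out k :=
  forall h : point -> 'cV[R]_d, depends_upto k h -> forall X a,
  int_above k
    (fun Y => (corrector_prod G k Y *m h Y) a ord0 * expR (- V Y / sigma)) X =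
  (K k X *m h X) a ord0.

(** The invariant of the recursion. Continuity, symmetry and the lower bound make level k a
    legitimate cell problem; the two bounds propagate because each weight at level k - 1 is the
    integral in x_k of the weight at level k. *)
Let good_tensor k := [/\ factors_out k,
  forall a b, continuous (fun X => K k X a b),
  forall X, (K k X)^T = K k X,
  forall X v, dotv v v / what k X <= dotv v (K k X *m v) &
  forall X v, dotv v (K k X *m v) <= w k X * dotv v v].

Lemma expR_continuous (W : point -> R) :
  continuous W -> continuous (fun X => expR (W X)).
Proof.
by move=> cW X; apply: continuous_comp; [exact: cW|exact: continuous_expR].
Qed.

Let ew_continuous : continuous (fun X => expR (- V X / sigma)).
Proof.
apply: expR_continuous; under eq_fun do rewrite mulrC.
move=> X; apply: (@cvgMl_tmp _ _ (nbhs X)); apply: (@cvgN _ _ _ (nbhs X)).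
exact: V_continuous.
Qed.

Let ewhat_continuous : continuous (fun X => expR (V X / sigma)).
Proof.
apply: expR_continuous; under eq_fun do rewrite mulrC.
by move=> X; apply: (@cvgMl_tmp _ _ (nbhs X)); exact: V_continuous.
Qed.

Let what_continuous k : continuous (what k).
Proof. exact: int_above_continuous. Qed.

Let what_gt0 k X : 0 < what k X.
Proof. by apply: int_above_gt0 => // Y; exact: expR_gt0. Qed.

Lemma good_tensor_max : good_tensor ord_max.
Proof.
have KE X : K ord_max X = (expR (- V X / sigma))%:M.
  apply/matrixP => a b; rewrite mxE int_above_max corrector_prod_max !mxE.
  by rewrite mulr_natl.
split.
- move=> h _ X a; rewrite int_above_max corrector_prod_max mul1mx KE.
  by rewrite mul_scalar_mx !mxE mulrC.
- move=> a b; under eq_fun do rewrite KE mxE -mulr_natl.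
  by move=> X; apply: (@cvgMl_tmp _ _ (nbhs X)); exact: ew_continuous.
- by move=> X; rewrite KE tr_scalar_mx.
- move=> X v; rewrite KE mul_scalar_mx dotvZr /what int_above_max.
  by rewrite -expRN -mulNr mulrC.
- by move=> X v; rewrite KE mul_scalar_mx dotvZr /w int_above_max.
Qed.

Lemma slice_corrector k X : (0 < k)%N ->
  cell_corrector (fun y => K k (set_row X k y)) (fun y => G k (set_row X k y)).
Proof.
move=> k0; have [_ _ gG eqG] := thetaG k0.
split; last by move=> e g [phi]; exact: eqG.
by move=> b; exists (fun y => theta k (set_row X k y) b ord0); exact: gG.
Qed.

Lemma depends_upto_set_row k (k' : 'I_N.+1) (T : Type) (h : point -> T) X y :
  (k' < k)%N -> depends_upto k' h -> h (set_row X k y) = h X.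
Proof.
move=> k'k; apply => i ik'; rewrite row_set_row; case: eqP => // ik.
by move: ik'; rewrite ik leqNgt k'k.
Qed.

Lemma depends_upto_corrector k (h : point -> 'cV[R]_d) : (0 < k)%N ->
  depends_upto k h -> depends_upto k (fun Y => (1%:M + G k Y) *m h Y).
Proof.
move=> k0 hh X Y XY; rewrite (hh X Y XY).
by have [_ [GG _] _ _] := thetaG k0; rewrite (GG X Y XY).
Qed.

(** Apply [factors_out] to the columns of I + G_k, which depend only on the rows up to k: the
    integral over the rows above k leaves K_k (I + G_k), and the one in x_k homogenizes it. *)
Lemma tensorK_homogenized k k' X : k = k'.+1 :> nat -> factors_out k ->
  K k' X = hom k X.
Proof.
move=> kk' fo; have k0 : (0 < k)%N by rewrite kk'.
apply/matrixP => a b; rewrite !mxE (int_above_recl _ kk').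
congr torus_int; apply/funext => y.
pose h (Y : point) := (1%:M + G k Y) *m (delta_mx b ord0 : 'cV[R]_d).
rewrite -[RHS](dotv_delta_mulmx _ a b) dotv_delta -mulmxA -(fo h).
  apply: (congr1 (fun F => int_above k F _)); apply/funext => Y.
  rewrite (corrector_prod_recr _ _ kk') /h mulmxA.
  by rewrite -(dotv_delta_mulmx _ a b) dotv_delta.
by apply: depends_upto_corrector => // Y Z _.
Qed.

Lemma good_tensor_pred k k' : k = k'.+1 :> nat ->
  good_tensor k -> good_tensor k'.
Proof.
move=> kk' [fo cK sK Kge Kle]; have k0 : (0 < k)%N by rewrite kk'.
have KE X := tensorK_homogenized X kk' fo.
have sc X := slice_corrector X k0.
have st X := slice_tensor k cK sK (what_gt0 k) Kge X.
have IA X a b := cell_integrable_homogenized (st X) (sc X) a b.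
split.
- move=> h hh X a; rewrite (int_above_recl _ kk') KE /int_row mxE.
  transitivity (torus_int (fun y => \sum_b h X b ord0 *
    (K k (set_row X k y) *m (1%:M + G k (set_row X k y))) a b)).
    congr torus_int; apply/funext => y.
    transitivity ((K k (set_row X k y) *m
      ((1%:M + G k (set_row X k y)) *m h (set_row X k y))) a ord0).
      (* The new factor is absorbed in the vector field: (I + G_k) h still depends only on the rows
         up to k. *)
      rewrite -(fo (fun Y => (1%:M + G k Y) *m h Y)); last first.
        apply: depends_upto_corrector => // Y Z YZ; apply: hh => i ik'.
        by apply: YZ; rewrite kk' ltnW.
      apply: (congr1 (fun F => int_above k F _)); apply/funext => Y.
      by rewrite (corrector_prod_recr _ _ kk') mulmxA.
    (* [h] does not see row k, so it is constant along the slice and leaves the integral in x_k. *)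
    rewrite (depends_upto_set_row _ _ _ hh) ?kk'// mulmxA mxE.
    by apply: eq_bigr => b _; rewrite mulrC.
  rewrite torus_int_sum; last by move=> b; exact: cell_integrableZ.
  by apply: eq_bigr => b _; rewrite torus_intZ// mxE mulrC.
- move=> a b; under eq_fun do rewrite KE.
  exact: (homogenized_continuous cK sK (what_continuous (k := k))
    (what_gt0 k) Kge sc).
- by move=> X; rewrite KE (homogenized_sym (st X) (sc X)).
- move=> X v; rewrite KE /what (int_above_recl _ kk').
  have cw : continuous (fun y => what k (set_row X k y)).
    by apply: (continuous_slice (F := what k)).
  apply: (homogenized_ge (st X) (sc X) v cw) => //; exact: torus_int_gt0.
- move=> X v; rewrite KE /w (int_above_recl _ kk').
  have cw : continuous (fun y => w k (set_row X k y)).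
    by apply: (continuous_slice (F := w k)); exact: int_above_continuous.
  exact: (homogenized_le (st X) (sc X) v cw).
Qed.

Lemma good_tensorP k : good_tensor k.
Proof.
(* Induction on N - k, descending from [ord_max]. *)
have [m] := ubnP (N - k); elim: m k => // m ih k; rewrite ltnS => Nkm.
have [kN|kN] := eqVneq (k : nat) N.
  by rewrite (_ : k = ord_max); [exact: good_tensor_max|exact: val_inj].
have kN' : (k.+1 < N.+1)%N by rewrite ltnS ltn_neqAle kN -ltnS ltn_ord.
apply: (@good_tensor_pred (Ordinal kN')) => //; apply: ih => /=.
by rewrite (leq_trans _ Nkm)// subnS prednK// subn_gt0 -ltnS.
Qed.

Lemma tensorK_sym k X : (tensorK sigma V G k X)^T = tensorK sigma V G k X.
Proof. by have [_ _ + _ _] := good_tensorP k; apply. Qed.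

Lemma tensorK_ge k X v :
  dotv v v / int_above k (fun X => expR (V X / sigma)) X <=
  dotv v (tensorK sigma V G k X *m v).
Proof. by have [_ _ _ + _] := good_tensorP k; apply. Qed.

Lemma tensorK_le k X v : dotv v (tensorK sigma V G k X *m v) <=
  int_above k (fun X => expR (- V X / sigma)) X * dotv v v.
Proof. by have [_ _ _ _] := good_tensorP k; apply. Qed.

End iterated_homogenization.

(** * Elimination of V0 and bounds by the oscillation of V1 *)

Theorem proposition2p5 (R : realType) (d N : nat) (sigma : R)
    (V0 : 'rV[R]_d -> R) (V1 V : 'M[R]_(N.+1, d) -> R)
    (theta : 'I_N.+1 -> 'M[R]_(N.+1, d) -> 'cV[R]_d)
    (G : 'I_N.+1 -> 'M[R]_(N.+1, d) -> 'M[R]_d) :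
  (0 < d)%N -> (0 < N)%N -> 0 < sigma ->
  separable_potential V0 V1 V ->
  correctors sigma V theta G ->
  let M := effective_diffusion sigma V G in
  let Z1 := partition_fun (fun X => - V1 X / sigma) in
  let Z1hat := partition_fun (fun X => V1 X / sigma) in
  uniformly_posdef M /\
  forall (x : 'rV[R]_d) (e : 'cV[R]_d), enorm e = 1 ->
    [/\ 0 < expR (- osc V1 / sigma),
        expR (- osc V1 / sigma) <= 1 / (Z1 x * Z1hat x),
        1 / (Z1 x * Z1hat x) <= dotv e (M x *m e) &
        dotv e (M x *m e) <= 1].
Proof.
move=> d0 N0 s0 [VE sV _ sV0 _ _ _ sV1 _ [C V1C]] thetaG M Z1 Z1hat.
have cV := smooth_continuous sV; have cV1 := smooth_continuous sV1.
have exp_cont (W : 'M[R]_(N.+1, d) -> R) :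
    continuous W -> continuous (fun X => expR (W X / sigma)).
  move=> cW; apply: expR_continuous; under eq_fun do rewrite mulrC.
  by move=> X; apply: (@cvgMl_tmp _ _ (nbhs X)); exact: cW.
have cNV1 : continuous (fun X => - V1 X).
  by move=> X; apply: (@cvgN _ _ _ (nbhs X)); exact: cV1.
have Z1_gt0 x : 0 < Z1 x.
  apply: int_above_gt0 => [|X]; last exact: expR_gt0.
  exact: (exp_cont (fun X => - V1 X)).
have Z1hat_gt0 x : 0 < Z1hat x.
  by apply: int_above_gt0 => [|X]; [exact: exp_cont|exact: expR_gt0].
have row0_upto (c : 'rV[R]_d -> R) :
    depends_upto (ord0 : 'I_N.+1) (fun X => c (row ord0 X)).
  by move=> X Y /(_ ord0 (leqnn _)) ->.
have row0E x : row ord0 (slow_point (N := N) x) = x by rewrite row_set_row eqxx.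
(* V0 depends on x_0 alone, so its exponential leaves the integrals over the fast variables. *)
have ZE x : partition_fun (fun X => - V X / sigma) x =
    expR (- V0 x / sigma) * Z1 x.
  rewrite /partition_fun.
  under eq_fun do rewrite VE opprD mulrDl expRD.
  rewrite (int_aboveZ (c := fun X => expR (- V0 (row ord0 X) / sigma))).
  - by rewrite row0E.
  - exact: (exp_cont (fun X => - V1 X)).
  - exact: (row0_upto (fun x => expR (- V0 x / sigma))).
have ZhatE x : partition_fun (fun X => V X / sigma) x =
    expR (V0 x / sigma) * Z1hat x.
  rewrite /partition_fun.
  under eq_fun do rewrite VE mulrDl expRD.
  rewrite (int_aboveZ (c := fun X => expR (V0 (row ord0 X) / sigma))).
  - by rewrite row0E.
  - exact: exp_cont.
  - exact: (row0_upto (fun x => expR (V0 x / sigma))).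
have Z_gt0 x : 0 < partition_fun (fun X => - V X / sigma) x.
  by rewrite ZE mulr_gt0// expR_gt0.
have M_sym x : (M x)^T = M x.
  by rewrite /M /effective_diffusion linearZ/= (tensorK_sym cV thetaG).
have M_ge x e : dotv e e / (Z1 x * Z1hat x) <= dotv e (M x *m e).
  rewrite /M /effective_diffusion -scalemxAl dotvZr [leRHS]mulrC ler_pdivlMr//.
  apply: le_trans (tensorK_ge cV thetaG ord0 (slow_point x) e).
  (* The factors exp(-V0/sigma) and exp(V0/sigma) are reciprocal, so only V1 survives in the product
     of the two partition functions. *)
  rewrite -/(partition_fun (fun X => V X / sigma) x) ZE ZhatE.
  rewrite le_eqVlt; apply/orP; left; apply/eqP.
  rewrite mulNr expRN; field.
  by rewrite !gt_eqF// expR_gt0.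
have M_le x e : dotv e (M x *m e) <= dotv e e.
  rewrite /M /effective_diffusion -scalemxAl dotvZr mulrC ler_pdivrMr// mulrC.
  exact: (tensorK_le cV thetaG).
have ub X : V1 X <= sup (range V1).
  apply: ub_le_sup; last by exists X.
  by exists C => _ [Y _ <-]; exact: le_trans (ler_norm _) (V1C Y).
have lb X : inf (range V1) <= V1 X.
  apply: ge_inf; last by exists X.
  by exists (- C) => _ [Y _ <-]; have := V1C Y; rewrite ler_norml => /andP[].
have Z1_le x : Z1 x <= expR (- inf (range V1) / sigma).
  (* The bound is written as the iterated integral of a constant, the torus having volume 1, so that
     integrands can be compared. *)
  rewrite -[leRHS](congr1 (@^~ (slow_point x))
    (int_above_cst (d := d) (ord0 : 'I_N.+1) _)).
  apply: le_int_above;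
    [exact: (exp_cont (fun X => - V1 X))|exact: cst_continuous|].
  by move=> X; rewrite ler_expR ler_pM2r ?invr_gt0// lerN2.
have Z1hat_le x : Z1hat x <= expR (sup (range V1) / sigma).
  rewrite -[leRHS](congr1 (@^~ (slow_point x))
    (int_above_cst (d := d) (ord0 : 'I_N.+1) _)).
  apply: le_int_above; [exact: exp_cont|exact: cst_continuous|].
  by move=> X; rewrite ler_expR ler_pM2r ?invr_gt0.
have osc_le x : expR (- osc V1 / sigma) <= 1 / (Z1 x * Z1hat x).
  rewrite div1r -[leLHS]invrK lef_pV2 ?posrE ?invr_gt0 ?expR_gt0 ?mulr_gt0//.
  rewrite -expRN mulNr opprK /osc mulrBl addrC -mulNr expRD.
  by apply: ler_pM => //; exact: ltW.
split.
  (* The oscillation bound does not depend on x and serves as the uniform ellipticity constant. *)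
  split=> //; exists (expR (- osc V1 / sigma)); first exact: expR_gt0.
  move=> x e; apply: le_trans (M_ge x e); rewrite mulrC.
  by rewrite ler_wpM2l ?dotvv_ge0// -[leRHS]div1r.
move=> x e e1.
have ee : dotv e e = 1.
  by rewrite -[LHS]sqr_sqrtr ?dotvv_ge0// -/(enorm e) e1 expr1n.
split; [exact: expR_gt0|exact: osc_le| |].
- by rewrite -ee; exact: M_ge.
- by rewrite -[leRHS]ee; exact: M_le.
Qed.
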